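(* If $\Delta$ is any simplicial complex of subsets of $\{1,\dots,n\}$, then in $S_\Delta$ $$P_\Delta=\sqrt{K_\Delta+Q_\Delta},$$ where $P_\Delta=\ker\sigma_\Delta$, $K_\Delta=\ker\tau_\Delta$ and $Q_\Delta=\ker\eta_\Delta$.
   Context: $\mathbb K$ is a field, $a_1,\dots,a_n$ positive integers, $R=\mathbb K[x_{i_1,\dots,i_n}:1\le i_j\le a_j]$. For a tuple $\sigma$ with $\sigma_j\in\{1,\dots,a_j\}\cup\{+\}$, $x_\sigma$ is the sum of all $x_{i_1,\dots,i_n}$ with $i_j=\sigma_j$ whenever $\sigma_j\ne+$. A simplicial complex is a nonempty family of subsets of $\{1,\dots,n\}$ closed under subsets. $S_\Delta$ is the polynomial ring over $\mathbb K$ in variables $X_\sigma$, one for each tuple $\sigma$ with $\sigma_j\in\{1,\dots,a_j\}\cup\{\bullet\}$ and $\{j:\sigma_j\ne\bullet\}\in\Delta$. $\tau_\Delta:S_\Delta\to R$ sends $X_\sigma\mapsto x_{\sigma''}$, where $\sigma''$ replaces each $\bullet$ by $+$. $\sigma_\Delta:S_\Delta\to\mathbb K[y_{j,i}:1\le j\le n,1\le i\le a_j]$ sends $X_\sigma\mapsto\prod_j y_{j,\sigma_j}$, where $y_{j,\bullet}$ is interpreted as $y_{j,+}=\sum_{i=1}^{a_j}y_{j,i}$ (equivalently, $\sigma_\Delta$ is $\tau_\Delta$ followed by the Segre map $x_{i_1,\dots,i_n}\mapsto\prod_j y_{j,i_j}$). $\eta_\Delta:S_\Delta\to\mathbb K[y_{j,i}:1\le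 j\le n,\ i\in\{1,\dots,a_j\}\cup\{\bullet\}]$, where the $y_{j,\bullet}$ are new independent variables, sends $X_\sigma\mapsto\prod_j y_{j,\sigma_j}$. *)

(* Defs.v *)
From HB Require Import structures.
From mathcomp Require Import all_boot all_order all_algebra.
From mathcomp Require Export mpoly.
Set Implicit Arguments. Unset Strict Implicit. Unset Printing Implicit Defensive.
Import Order.TTheory GRing.Theory Num.Theory.
Local Open Scope ring_scope.

Definition polyT (K : fieldType) (T : finType) := {mpoly K[#|T|]}.
Definition varT (K : fieldType) (T : finType) (t : T) : polyT K T :=
  'X_(enum_rank t).

Definition substT (K : fieldType) (T U : finType) (f : T -> polyT K U)
  (p : polyT K T) : polyT K U :=
  comp_mpoly [tuple f (enum_val i) | i < #|T|] p.

Section Sdelta.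
Variables (K : fieldType) (n : nat) (a : 'I_n -> nat).

(* indices (i_1,...,i_n), i_j in {1..a_j} (here 'I_(a j) = {0..a_j-1}) *)
Definition idxR := {dffun forall j : 'I_n, 'I_(a j)}.
(* tuples with entries in {1..a_j} u {bullet}; None = bullet *)
Definition btuple := {dffun forall j : 'I_n, option 'I_(a j)}.
Definition supp (s : btuple) : {set 'I_n} := [set j | s j != None].

Definition RingR := polyT K idxR.
Definition xplus (s : btuple) : RingR :=
  \sum_(i : idxR | [forall j, if s j is Some k then i j == k else true])
     varT K i.

Definition SVar (D : {set {set 'I_n}}) := {s : btuple | supp s \in D}.
Definition SDelta (D : {set {set 'I_n}}) := polyT K (SVar D).

Definition yIdx := {j : 'I_n & 'I_(a j)}.
Definition Yring := polyT K yIdx.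
Definition ybIdx := {j : 'I_n & option 'I_(a j)}.
Definition Ybring := polyT K ybIdx.

Definition yplus (j : 'I_n) (o : option 'I_(a j)) : Yring :=
  if o is Some i then varT K (Tagged (fun j => 'I_(a j)) i)
  else \sum_(i : 'I_(a j)) varT K (Tagged (fun j => 'I_(a j)) i).

Definition tauD (D : {set {set 'I_n}}) (p : SDelta D) : RingR :=
  substT (fun s : SVar D => xplus (val s)) p.
Definition sigmaD (D : {set {set 'I_n}}) (p : SDelta D) : Yring :=
  substT (fun s : SVar D => \prod_(j : 'I_n) yplus (val s j)) p.
Definition etaD (D : {set {set 'I_n}}) (p : SDelta D) : Ybring :=
  substT (fun s : SVar D =>
     \prod_(j : 'I_n) varT K (Tagged (fun j => option 'I_(a j)) (val s j))) p.

End Sdelta.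

Definition simplicial_complex (n : nat) (D : {set {set 'I_n}}) : Prop :=
  D != set0 /\ forall A B : {set 'I_n}, A \in D -> B \subset A -> B \in D.

(* Main.v *)
Require Import Defs.
From HB Require Import structures.
From mathcomp Require Import all_boot all_order all_algebra.
From mathcomp Require Import mpoly.
Import GRing.Theory.
Local Open Scope ring_scope.

(** One even has P = K + Q, with no radical. Fix an index i0 in each range
    {1..a_j}. Modulo K an entry i0 can be eliminated from a variable X_sigma by
    X_{..i0..} = X_{..bullet..} - sum_{i <> i0} X_{..i..}, so every p is
    congruent modulo K to a polynomial q in those X_sigma that avoid i0. On such
    polynomials sigma and eta have the same kernel, because y_{j,+} and the
    y_{j,i} with i <> i0 are algebraically independent. Hence sigma p = 0
    gives eta q = 0. *)

Set Implicit Arguments.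
Unset Strict Implicit.
Unset Printing Implicit Defensive.

(** Serves to expand a product of sums $y_{j,+}$ whose ranges vary with $j$. [big_tag] moves all the
    sums to one tagged type, where the usual distributive law applies; [Q] is absorbed beforehand as
    zero summands. *)
Lemma bigA_distr_dffun (R : comPzSemiRingType) (I : finType) (T : I -> finType)
    (Q : forall i, pred (T i)) (F : forall i, T i -> R) :
  \prod_i \sum_(x | Q i x) F i x =
  \sum_(f : {dffun forall i, T i} | [forall i, Q i (f i)]) \prod_i F i (f i).
Proof.
pose P i := [ffun x : T i => if Q i x then F i x else 0].
transitivity (\prod_i \sum_(x : T i) P i x).
  apply: eq_bigr => i _; rewrite big_mkcond.
  by apply: eq_bigr => x _; rewrite ffunE.
under eq_bigr => i _ do rewrite (big_tag (fun i x => P i x) i).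
rewrite bigA_distr_big_dep -big_fprod.
rewrite (reindex (@fprod_of_dffun _ T)) /=; last first.
  exact/onW_bij/fprod_of_dffun_bij.
rewrite [RHS]big_mkcond; apply: eq_bigr => f _.
under eq_bigr do rewrite fprodE ffunE.
case: ifPn => [/forallP Qf|/forallPn[i /negPf Qi]].
  by apply: eq_bigr => i _; rewrite Qf.
by rewrite (bigD1 i) //= Qi mul0r.
Qed.

Section Substitution.
Variable K : fieldType.
Implicit Types T U V : finType.

HB.instance Definition _ T U (f : T -> polyT K U) :=
  GRing.RMorphism.copy (substT f)
    (@comp_mpoly _ _ _ [tuple f (enum_val i) | i < #|T|]).

Lemma substTC T U (f : T -> polyT K U) c : substT f c%:MP = c%:MP.
Proof. exact: comp_mpolyC. Qed.

Lemma substT_varT T U (f : T -> polyT K U) t : substT f (varT K t) = f t.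
Proof.
by rewrite /substT /varT comp_mpolyXU -tnth_nth tnth_mktuple enum_rankK.
Qed.

Lemma polyT_ind T (P : polyT K T -> Prop) :
    (forall c, P c%:MP) -> (forall t, P (varT K t)) ->
    (forall p q, P p -> P q -> P (p + q)) ->
    (forall p q, P p -> P q -> P (p * q)) ->
  forall p, P p.
Proof.
move=> PC PX PD PM; elim/mpolyind => [|c m p _ _ Pp]; first by rewrite -mpolyC0.
apply: (PD) => //; rewrite -mul_mpolyC; apply: (PM) => //.
rewrite mpolyXE_id; elim/big_ind: _ => [||i _]; [by rewrite -mpolyC1|exact: PM|].
elim: (m i) => [|k IHk]; first by rewrite expr0 -mpolyC1.
rewrite exprS; apply: (PM) => //.
by have := PX (enum_val i); rewrite /varT enum_valK.
Qed.

Lemma eq_substT T U (f g : T -> polyT K U) : f =1 g -> substT f =1 substT g.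
Proof.
move=> fg; elim/polyT_ind => [c|t|p q IHp IHq|p q IHp IHq].
- by rewrite !substTC.
- by rewrite !substT_varT.
- by rewrite !rmorphD /= IHp IHq.
- by rewrite !rmorphM /= IHp IHq.
Qed.

Lemma substT_comp T U V (f : T -> polyT K U) (g : U -> polyT K V) p :
  substT g (substT f p) = substT (fun t => substT g (f t)) p.
Proof.
elim/polyT_ind: p => [c|t|p q IHp IHq|p q IHp IHq].
- by rewrite !substTC.
- by rewrite !substT_varT.
- by rewrite !rmorphD /= IHp IHq.
- by rewrite !rmorphM /= IHp IHq.
Qed.

End Substitution.

Section PDelta.
Variables (K : fieldType) (n : nat) (a : 'I_n -> nat).
Variable D : {set {set 'I_n}}.

HB.instance Definition _ := GRing.RMorphism.copy (@tauD K n a D)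
  (substT (fun s : SVar a D => xplus K (val s))).
HB.instance Definition _ := GRing.RMorphism.copy (@sigmaD K n a D)
  (substT (fun s : SVar a D => \prod_j yplus K (val s j))).
HB.instance Definition _ := GRing.RMorphism.copy (@etaD K n a D)
  (substT (fun s : SVar a D =>
     \prod_j varT K (Tagged (fun j => option 'I_(a j)) (val s j)))).

Definition segre (i : idxR a) : Yring K a :=
  \prod_j varT K (Tagged (fun j => 'I_(a j)) (i j)).

(** The indices summed in [xplus K s] form a product set, a singleton at each fixed entry and the
    full range at each bullet, so distributivity factors the sum of Segre monomials. *)
Lemma segre_xplus (s : btuple a) :
  substT segre (xplus K s) = \prod_j yplus K (s j).
Proof.
rewrite /xplus rmorph_sum /=; under eq_bigr do rewrite substT_varT.
rewrite -(bigA_distr_dffun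
  (fun j (x : 'I_(a j)) => if s j is Some k then x == k else true)
  (fun j x => varT K (Tagged (fun j => 'I_(a j)) x))).
apply: eq_bigr => j _; rewrite /yplus; case: (s j) => [k|//].
by rewrite big_pred1_eq.
Qed.

Lemma sigmaD_tauD (p : SDelta K a D) : sigmaD p = substT segre (tauD p).
Proof.
by rewrite /tauD substT_comp; apply: eq_substT => s; rewrite segre_xplus.
Qed.

(** Substituting $y_{j,+}$ for $y_{j,\bullet}$ after $\eta$ gives $\sigma$ on each variable; hence
    $Q \subseteq P$, just as factoring through $\tau$ gives $K \subseteq P$. *)
Lemma sigmaD_etaD (p : SDelta K a D) :
  sigmaD p = substT (fun t : ybIdx a => yplus K (tagged t)) (etaD p).
Proof.
rewrite /etaD substT_comp; apply: eq_substT => s.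
by rewrite rmorph_prod; apply: eq_bigr => j _; rewrite /= substT_varT.
Qed.

Definition upd (s : btuple a) j (o : option 'I_(a j)) : btuple a :=
  finfun (dfwith s o).
Arguments upd : clear implicits.

Lemma updE (s : btuple a) j o : upd s j o j = o.
Proof. by rewrite ffunE dfwith_in. Qed.

Lemma upd_neq (s : btuple a) j k (o : option 'I_(a j)) : j != k -> upd s j o k = s k.
Proof. by move=> jk; rewrite ffunE dfwith_out. Qed.

Lemma upd_id (s : btuple a) j : upd s j (s j) = s.
Proof.
apply/ffunP => k; have [<-|jk] := eqVneq j k; first exact: updE.
exact: upd_neq.
Qed.

Lemma supp_upd (s : btuple a) j (o : option 'I_(a j)) :
  j \in supp s -> supp (upd s j o) \subset supp s.
Proof.
move=> js; apply/subsetP => k; have [<-//|jk] := eqVneq j k.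
by rewrite !inE upd_neq.
Qed.

(** Sort the variables in the sum by their [j]-th index. *)
Lemma xplus_upd_bullet (s : btuple a) j :
  xplus K (upd s j None) = \sum_i xplus K (upd s j (Some i)).
Proof.
rewrite /xplus (partition_big (fun x : idxR a => x j) predT) //=.
apply: eq_bigr => i _; apply: eq_bigl => x.
apply/andP/forallP => [[/forallP xs /eqP xj] k|xs].
  have := xs k; have [<-|jk] := eqVneq j k; first by rewrite !updE xj eqxx.
  by rewrite !upd_neq.
split; last by have := xs j; rewrite updE.
apply/forallP => k; have := xs k.
by have [<-|jk] := eqVneq j k; [rewrite !updE | rewrite !upd_neq].
Qed.

Section Straightening.
Hypothesis a_gt0 : forall j, (0 < a j)%N.

Let i0 j : 'I_(a j) := Ordinal (a_gt0 j).
Let yb j (o : option 'I_(a j)) : Ybring K a :=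
  varT K (Tagged (fun j => option 'I_(a j)) o).

(* A section of y_{j,bullet} |-> y_{j,+}: it sends y_{j,+} to y_{j,bullet} and
   fixes y_{j,i} for i <> i0. *)
Definition straighten (t : yIdx a) : Ybring K a :=
  if tagged t == i0 (tag t)
  then yb (None : option 'I_(a (tag t))) - \sum_(i | i != i0 (tag t)) yb (Some i)
  else yb (Some (tagged t)).

Lemma straighten_yplus j (o : option 'I_(a j)) :
  o != Some (i0 j) -> substT straighten (yplus K o) = yb o.
Proof.
case: o => [i|_] /=.
  rewrite substT_varT /straighten /= => /negPf.
  by case: ifP => // /eqP ->; rewrite eqxx.
rewrite rmorph_sum (bigD1 (i0 j)) //= substT_varT /straighten /= ?eqxx.
under [X in _ + X]eq_bigr => i /negPf ii0 do rewrite substT_varT /= ii0.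
exact: subrK.
Qed.

(** The second equation stands in for [r] being a polynomial in variables that avoid [i0]. It is
    stable under ring operations, and it is all that is needed to pass from [sigmaD r = 0] to
    [etaD r = 0]. *)
Definition liftable (x : RingR K a) := exists r : SDelta K a D,
  tauD r = x /\ substT straighten (sigmaD r) = etaD r.

Lemma liftableC c : liftable c%:MP.
Proof. by exists c%:MP; rewrite /tauD /sigmaD /etaD !substTC. Qed.

Lemma liftableD x y : liftable x -> liftable y -> liftable (x + y).
Proof.
move=> [p [<- Ep]] [q [<- Eq]]; exists (p + q).
by rewrite !rmorphD /= Ep Eq.
Qed.

Lemma liftableB x y : liftable x -> liftable y -> liftable (x - y).
Proof.
move=> [p [<- Ep]] [q [<- Eq]]; exists (p - q).
by rewrite !rmorphB /= Ep Eq.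
Qed.

Lemma liftableM x y : liftable x -> liftable y -> liftable (x * y).
Proof.
move=> [p [<- Ep]] [q [<- Eq]]; exists (p * q).
by rewrite !rmorphM /= Ep Eq.
Qed.

Hypothesis D_sub : forall A B : {set 'I_n}, A \in D -> B \subset A -> B \in D.

(* Induction on the number of entries equal to i0: such an entry is eliminated
   by x_{..i0..} = x_{..+..} - sum_{i <> i0} x_{..i..}. *)
Lemma liftable_xplus (s : btuple a) : supp s \in D -> liftable (xplus K s).
Proof.
pose bad (s : btuple a) := [set j | s j == Some (i0 j)].
have [m] := ubnP #|bad s|; elim: m s => // m IHm s le_sm sD.
have [bad0|[j]] := set_0Vmem (bad s).
  (* With no entry [i0], the variable $X_s$ is its own lift. *)
  exists (varT K (exist _ s sD)); rewrite /tauD /sigmaD /etaD !substT_varT.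
  split=> //; rewrite rmorph_prod; apply: eq_bigr => j _.
  by apply: straighten_yplus; have := in_set0 j; rewrite -bad0 inE => ->.
rewrite inE => /eqP sj; have js : j \in supp s by rewrite inE sj.
have lift_upd (o : option 'I_(a j)) : o != Some (i0 j) -> liftable
    (xplus K (upd s j o)).
  (* Since [j] is already in the support, changing this entry cannot enlarge it, so closure under
     subsets keeps the new variable in $S_\Delta$. The bad set loses [j] and gains nothing. *)
  move=> oi0; apply: IHm; last exact: D_sub (supp_upd o js).
  rewrite ltnS in le_sm; apply: leq_trans le_sm.
  apply/proper_card/properP; split.
    apply/subsetP => k; have [<-|jk] := eqVneq j k; last by rewrite !inE upd_neq.
    by rewrite inE updE (negPf oi0).
  by exists j; rewrite inE ?sj // updE.
have -> : xplus K s = xplus K (upd s j None) -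
    \sum_(i | i != i0 j) xplus K (upd s j (Some i)).
  by rewrite xplus_upd_bullet (bigD1 (i0 j)) //= addrK -sj upd_id.
apply: liftableB; first exact: lift_upd.
elim/big_ind: _ => [||i ii0]; first by rewrite -mpolyC0; apply: liftableC.
  exact: liftableD.
exact: lift_upd.
Qed.

Lemma liftable_tauD (p : SDelta K a D) : liftable (tauD p).
Proof.
elim/polyT_ind: p => [c|[s sD]|p q|p q].
- by rewrite /tauD substTC; apply: liftableC.
- by rewrite /tauD substT_varT; apply: liftable_xplus.
- by rewrite rmorphD; apply: liftableD.
- by rewrite rmorphM; apply: liftableM.
Qed.

(** Take for [q] the lift of [tauD p]. Then [p - q] lies in $K$, and since $\sigma$ factors through
    $\tau$, [sigmaD q = sigmaD p = 0]; straightening turns this into [etaD q = 0]. *)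
Lemma ker_sigmaD_sub (p : SDelta K a D) : sigmaD p = 0 ->
  exists k q : SDelta K a D, [/\ tauD k = 0, etaD q = 0 & p = k + q].
Proof.
move=> p0; have [q [Eq_tau Eq_eta]] := liftable_tauD p.
exists (p - q), q; split; last by rewrite subrK.
  by rewrite rmorphB /= Eq_tau subrr.
by rewrite -Eq_eta sigmaD_tauD Eq_tau -sigmaD_tauD p0 rmorph0.
Qed.

End Straightening.
End PDelta.

Unset Implicit Arguments.

(* P_Delta = sqrt(K_Delta + Q_Delta): p in ker sigma  iff  some power of p is
   a sum k + q with k in ker tau and q in ker eta. *)
Theorem theorem5p1 (K : fieldType) (n : nat) (a : 'I_n -> nat)
  (ha : forall j, (0 < a j)%N) (D : {set {set 'I_n}}) :
  simplicial_complex D ->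
  forall p : SDelta K a D,
    sigmaD p = 0 <->
    exists (m : nat) (k q : SDelta K a D),
      tauD k = 0 /\ etaD q = 0 /\ p ^+ m = k + q.
Proof.
move=> [_ D_sub] p; split=> [p0|[m [k [q [k0 [q0 pm]]]]]].
  have [k [q [k0 q0 ->]]] := ker_sigmaD_sub ha D_sub p0.
  by exists 1%N, k, q.
(* $\sigma$ kills both [k] and [q], and its target is an integral domain; for [m = 0] the equation
   would read $1 = 0$. *)
apply/eqP; have : sigmaD p ^+ m == 0.
  by rewrite -rmorphXn pm rmorphD /= sigmaD_tauD sigmaD_etaD k0 q0 !rmorph0 addr0.
by rewrite expf_eq0 => /andP[].
Qed.
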